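(* Consider the scalar binary signaling game under the Nash assumption, with the receiver restricted to single-threshold rules, as described in the context. Let the transmitter's parameters be perturbations of the (fixed) receiver's parameters: $\pi_i^t=\pi_i^r+\epsilon_{\pi i}$ and $C^t_{ji}=C^r_{ji}+\epsilon_{ji}$ for $i,j\in\{0,1\}$, where $\boldsymbol\epsilon=\{\epsilon_{\pi0},\epsilon_{\pi1},\epsilon_{00},\epsilon_{01},\epsilon_{10},\epsilon_{11}\}\in\mathbb R^6$. Let $\tau\triangleq\frac{\pi_0^r(C^r_{10}-C^r_{00})}{\pi_1^r(C^r_{01}-C^r_{11})}$, assume $0<\tau<\infty$, and let $\zeta\triangleq\mathrm{sgn}(C^r_{01}-C^r_{11})$. If $$\left|\frac{\epsilon_{10}-\epsilon_{00}}{C^r_{10}-C^r_{00}}\right|<1\quad\text{and}\quad\left|\frac{\epsilon_{01}-\epsilon_{11}}{C^r_{01}-C^r_{11}}\right|<1,$$ then $\xi_0\triangleq\frac{C^t_{10}-C^t_{00}}{C^r_{10}-C^r_{00}}>0$ and $\xi_1\triangleq\frac{C^t_{01}-C^t_{11}}{C^r_{01}-C^r_{11}}>0$, and the informative Nash equilibrium policies do not change with $\boldsymbol\epsilon$: they are given by either $$(S_0^*,S_1^*,a^*,\eta^* )=\left(-\zeta\sqrt{P_0},\ \zeta\sqrt{P_1},\ \sqrt{P_0}+\sqrt{P_1},\ \zeta\left(\sigma^2\ln\tau+\frac{(S_1^* )^2-(S_0^* )^2}{2}\right)\right)$$ or $$(S_0^*,S_1^*,a^*,\eta^* )=\left(\zeta\sqrt{P_0},\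 -\zeta\sqrt{P_1},\ -(\sqrt{P_0}+\sqrt{P_1}),\ \zeta\left(\sigma^2\ln\tau+\frac{(S_1^* )^2-(S_0^* )^2}{2}\right)\right).$$ In particular, the Nash equilibrium is robust to, and its policies are continuous with respect to, small perturbations of priors and costs around the point of identical priors and costs.
   Context: Binary signaling game: there are two hypotheses $\mathcal H_0: Y=S_0+N$ and $\mathcal H_1: Y=S_1+N$, where $Y$ takes values in $\Gamma=\mathbb R$, $S_0,S_1\in\mathbb R$ are deterministic signals and $N\sim\mathcal N(0,\sigma^2)$, $\sigma>0$. The transmitter ($t$) chooses $\mathcal S=\{S_0,S_1\}$ in $\mathbb S=\{\mathcal S:|S_0|^2\le P_0,\ |S_1|^2\le P_1\}$, with power limits $P_0,P_1>0$. The receiver ($r$) chooses a decision rule $\delta$, deciding $\mathcal H_i$ when $y\in\Gamma_i$, where $\Gamma_0,\Gamma_1$ partition $\Gamma$. Policies are deterministic and the receiver is restricted to the set $\Delta$ of single-threshold rules: for some $a,\eta\in\mathbb R$, decide $\mathcal H_1$ if $ay>\eta$ and $\mathcal H_0$ if $ay<\eta$ (either in case of equality). Pairs $(a,\eta)$ with $a\ne0$ are normalized so that the receiver's best response to signals $S_0\neq S_1$ is written with $a=\zeta(S_1-S_0)$ (positive rescaling of $(a,\eta)$ gives the same rule). Put $\mathsf P_{ji}=\Pr(Y\in\Gamma_j\mid\mathcal H_i)$. For $j\in\{t,r\}$, player $j$ has priors $\pi_0^j,\pi_1^j\ge0$ with $\pi_0^j+\pi_1^j=1$ and costs $C^j_{kl}\ge0$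 (cost of deciding $\mathcal H_k$ when $\mathcal H_l$ is true); the priors are mutually absolutely continuous: $\pi_i^t=0\iff\pi_i^r=0$ (perturbations are such that the transmitter's perturbed parameters satisfy these constraints). Player $j$ has Bayes risk $$r^j(\mathcal S,\delta)=\pi_0^j(C^j_{00}\mathsf P_{00}+C^j_{10}\mathsf P_{10})+\pi_1^j(C^j_{01}\mathsf P_{01}+C^j_{11}\mathsf P_{11}).$$ Nash equilibrium: a pair $(\mathcal S^*,\delta^* )$ with $r^t(\mathcal S^*,\delta^* )\le r^t(\mathcal S,\delta^* )$ for all $\mathcal S\in\mathbb S$ and $r^r(\mathcal S^*,\delta^* )\le r^r(\mathcal S^*,\delta)$ for all $\delta\in\Delta$. An equilibrium is non-informative if it is achieved with a message that is useless for the receiver, i.e. $S_0^*=S_1^*$ and $\delta^*$ uses only the priors, or $\delta^*$ ignores the observation (e.g. $a^*=0$); otherwise it is informative. $\mathrm{sgn}(x)=-1,0,1$ for $x<0$, $x=0$, $x>0$. *)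

(* Defs.v *)
(* MathComp-Analysis, over an arbitrary R : realType. *)
From HB Require Import structures.
From mathcomp Require Import all_boot all_order all_algebra.
From mathcomp Require Import all_classical all_reals all_analysis.

Set Implicit Arguments.
Unset Strict Implicit.
Unset Printing Implicit Defensive.

Import Order.TTheory GRing.Theory Num.Theory.
Import numFieldNormedType.Exports.

Local Open Scope classical_set_scope.
Local Open Scope ring_scope.

(* The two hypotheses, and also the two possible decisions. *)
Notation H0 := false (only parsing).
Notation H1 := true (only parsing).

(* [cost p k l] is C_{kl}, the cost of deciding H_k when H_l is true. *)
Record params (R : Type) := Params {
  prior : bool -> R ;
  cost : bool -> bool -> R }.

Section Game.
Variable R : realType.
Implicit Types (p t r : params R) (S : R * R) (delta : R -> bool).

Definition valid_params p :=
  [/\ forall i, 0 <= prior p i,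
      prior p H0 + prior p H1 = 1 &
      forall k l, 0 <= cost p k l].

Definition mutually_ac t r :=
  forall i, prior t i = 0 <-> prior r i = 0.

(* A perturbation is (eps_pi0, eps_pi1, eps_00, eps_01, eps_10, eps_11). *)
Definition eps_prior (e : R * R * R * R * R * R) (i : bool) : R :=
  let: (p0, p1, _, _, _, _) := e in if i then p1 else p0.

Definition eps_cost (e : R * R * R * R * R * R) (k l : bool) : R :=
  let: (_, _, e00, e01, e10, e11) := e in
  if k then (if l then e11 else e10) else (if l then e01 else e00).

Definition perturb r (e : R * R * R * R * R * R) : params R :=
  Params (fun i => prior r i + eps_prior e i)
         (fun k l => cost r k l + eps_cost e k l).

Definition admissible r (e : R * R * R * R * R * R) :=
  valid_params (perturb r e) /\ mutually_ac (perturb r e) r.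

Definition tau r : R :=
  (prior r H0 * (cost r H1 H0 - cost r H0 H0)) /
  (prior r H1 * (cost r H0 H1 - cost r H1 H1)).

Definition zeta r : R := Num.sg (cost r H0 H1 - cost r H1 H1).

Definition signal S (i : bool) : R := if i then S.2 else S.1.

Definition signal_set (P0 P1 : R) : set (R * R) :=
  [set S | `|S.1| ^+ 2 <= P0 /\ `|S.2| ^+ 2 <= P1].

(* [d] is the decision in case of equality.  It does not depend on y, so that
   the rules with a = 0 are the two constant rules, also when eta = 0. *)
Definition threshold_rule (a eta : R) (d : bool) : R -> bool :=
  fun y => if a * y == eta then d else eta < a * y.

Definition threshold_rules : set (R -> bool) :=
  [set delta | exists a eta d, delta = threshold_rule a eta d].

(* [decision_prob sigma S delta j i] is P_{ji} = Pr(S_i + N in Gamma_j), with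
   N ~ N(0, sigma^2); the second parameter of [normal_prob] is the standard
   deviation. *)
Definition decision_prob (sigma : R) S delta (j i : bool) : R :=
  fine (normal_prob 0 sigma [set n : R | delta (signal S i + n) = j]).

Definition bayes_risk (sigma : R) p S delta : R :=
  prior p H0 * (cost p H0 H0 * decision_prob sigma S delta H0 H0 +
                cost p H1 H0 * decision_prob sigma S delta H1 H0) +
  prior p H1 * (cost p H0 H1 * decision_prob sigma S delta H0 H1 +
                cost p H1 H1 * decision_prob sigma S delta H1 H1).

Definition nash (sigma P0 P1 : R) t r S delta :=
  [/\ signal_set P0 P1 S,
      threshold_rules delta,
      forall S', signal_set P0 P1 S' ->
        bayes_risk sigma t S delta <= bayes_risk sigma t S' delta &
      forall delta', threshold_rules delta' ->
        bayes_risk sigma r S delta <= bayes_risk sigma r S delta'].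

(* A rule that uses only the priors is constant in the observation as well, so
   this also covers the case S_0 = S_1 of a non-informative equilibrium. *)
Definition ignores_observation delta := forall y y', delta y = delta y'.

Definition informative_nash (sigma P0 P1 : R) t r S delta :=
  nash sigma P0 P1 t r S delta /\ ~ ignores_observation delta.

(* Quadruples (S_0, S_1, a, eta): (a, eta) is determined by the rule only up to
   a positive factor, which is fixed by a = zeta (S_1 - S_0). *)
Definition informative_policies (sigma P0 P1 : R) t r : set (R * R * R * R) :=
  [set q | let: (S0, S1, a, eta) := q in
     a = zeta r * (S1 - S0) /\
     exists d, informative_nash sigma P0 P1 t r (S0, S1)
                 (threshold_rule a eta d)].

(* The strategies (S, delta) described by the quadruple q, the decision in case
   of equality being free. *)
Definition plays (q : R * R * R * R) S delta :=
  let: (S0, S1, a, eta) := q in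
  S = (S0, S1) /\ exists d, delta = threshold_rule a eta d.

End Game.

(* Continuity at x, relative to A, of a set-valued map F: upper and lower
   hemicontinuity. *)
Definition continuous_set_valued (X Y : topologicalType) (A : set X)
    (F : X -> set Y) (x : X) :=
  forall U : set Y, open U ->
    (F x `<=` U -> \forall z \near within A (nbhs x), F z `<=` U) /\
    (F x `&` U !=set0 -> \forall z \near within A (nbhs x), F z `&` U !=set0).

(* Main.v *)
From HB Require Import structures.
Require Import Defs.
From mathcomp Require Import all_boot all_order all_algebra.
From mathcomp Require Import all_classical all_reals all_analysis.
From mathcomp Require Import measurable_realfun ring lra.

Import Order.TTheory GRing.Theory Num.Theory.
Import numFieldNormedType.Exports.

Local Open Scope classical_set_scope.
Local Open Scope ring_scope.

Set Implicit Arguments.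
Unset Strict Implicit.
Unset Printing Implicit Defensive.

(** Write [w_0 = pi_0 (C_10 - C_00)] and [w_1 = pi_1 (C_01 - C_11)] for the
    weighted costs of a player.  Up to a constant that depends neither on the
    signals nor on the rule, the Bayes risk is [w_0 P_10 - w_1 P_11].  Hence a
    player enters the game only through its two weights.  For [0 < tau], the
    weights of the receiver are nonzero and of the same sign [zeta].  The bounds
    on the perturbation ensure that the cost differences of the transmitter keep
    this sign ([xi_gt0], [sgr_weight_transmitter]).

    Against a rule with [a <> 0], the probability of deciding [H_1] is strictly
    increasing in [a s], where [s] is the signal sent ([decision_prob_lt]).  So
    the unique best response of the transmitter is a pair of end points of the
    signal intervals, which depends only on [zeta] and on the sign [b] of [a]
    ([transmitter_best_response]): the size of its weights is irrelevant.

    Against signals [S_0 <> S_1], the receiver minimises the integral over the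
    region of decision of [w_0 f_0 - w_1 f_1], where [f_i] is the Gaussian density
    centred at [S_i].  That function has the sign of [eta - a y] for
    [a = zeta (S_1 - S_0)] and [eta] the threshold of the likelihood ratio test
    ([sgr_risk_density]), so this rule is optimal ([threshold_rule_opt]).  It is
    the only optimal non-constant threshold rule, up to a positive factor and the
    decision at the threshold, because two thresholds that disagree do so on a
    nonempty open set ([threshold_rule_unique]).

    Combining both, the informative equilibria are the two policies [b = 1] and
    [b = -1] ([informative_nashP]), in which the perturbation does not occur.
    Against a constant rule the risk of the transmitter does not depend on the
    signals, so the remaining equilibria do not change either ([nash_ignores]).
    The bounds hold on a neighbourhood of [0], on which the set of informative
    policies is therefore constant, hence continuous. *)

(** * Gaussian measures and threshold rules *)

Section GaussianTests.
Variable R : realType.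
Local Notation mu := (@lebesgue_measure R).
Implicit Types (a eta s m sigma : R) (d : bool) (g f : R -> R) (A D U : set R).

(** Translation by [s], between copies of the line that carry the Borel
    sigma-algebra on which [lebesgue_measure] is defined. *)
Definition translation s : measurableTypeR R -> measurableTypeR R :=
  fun x => s + x.

Lemma measurable_translation s : measurable_fun setT (translation s).
Proof. exact: measurable_funD. Qed.

HB.instance Definition _ s :=
  isMeasurableFun.Build _ _ _ _ (translation s) (measurable_translation s).

Lemma lebesgue_measure_translation s A : measurable A ->
  pushforward mu (translation s) A = mu A.
Proof.
move=> mA; apply/esym/lebesgue_measure_unique => //= _ [[x y]] _ <-.
rewrite /pushforward.
have -> : translation s @^-1` `]x, y] = `]x - s, y - s]%classic.
  by apply/seteqP; split => z/=; rewrite /translation !in_itv/= ltrBlDl lerBrDl.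
by rewrite !lebesgue_measure_itv/= !lte_fin ltrD2r -!EFinB opprB addrA subrK.
Qed.

Lemma normal_pdf_gt0 m sigma x : sigma != 0 -> 0 < normal_pdf m sigma x.
Proof.
by move=> s0; rewrite normal_pdfE// mulr_gt0 ?normal_peak_gt0 ?expR_gt0.
Qed.

Lemma normal_pdf_translation m s sigma x : sigma != 0 ->
  normal_pdf (s + m) sigma (s + x) = normal_pdf m sigma x.
Proof.
by move=> s0; rewrite !normal_pdfE// /normal_fun opprD addrACA subrr add0r.
Qed.

Lemma normal_prob_translation m s sigma A : sigma != 0 -> measurable A ->
  normal_prob m sigma [set x | A (s + x)] = normal_prob (s + m) sigma A.
Proof.
move=> s0 mA; rewrite /normal_prob.
transitivity (\int[pushforward mu (translation s)]_(y in A)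
    (normal_pdf (s + m) sigma y)%:E)%E; last first.
  apply: eq_measure_integral => //= B mB _.
  exact: lebesgue_measure_translation.
rewrite (ge0_integral_pushforward (measurable_translation s) _ mA).
- by apply: eq_integral => x _; rewrite -(normal_pdf_translation m s x s0).
- apply/measurable_EFinP; apply: measurable_funTS; exact: measurable_normal_pdf.
- by move=> x _; rewrite lee_fin normal_pdf_ge0.
Qed.

(** Strict positivity needs [f] positive only on a nonempty open set, which has
    positive measure. *)
Lemma Rintegral_gt0 D U f : measurable D -> mu.-integrable D (EFin \o f) ->
  (forall x, D x -> 0 <= f x) -> (forall x, U x -> 0 < f x) ->
  open U -> U !=set0 -> U `<=` D -> 0 < \int[mu]_(x in D) f x.
Proof.
move=> mD iD f0 fU oU [u Uu] UD; rewrite lt_neqAle Rintegral_ge0// andbT.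
apply/eqP => /esym I0.
have absI0 : (\int[mu]_(x in D) `|(EFin \o f) x| = 0)%E.
  under eq_integral => x /set_mem Dx do rewrite /= ger0_norm ?f0//.
  rewrite -[LHS]fineK; first by congr EFin.
  exact: (@integrable_fin_num _ _ _ mu).
have fae0 := (ae_eq_integral_abs mu mD (measurable_int mu iD)).1 absI0.
have [e/= e0 eU] := (iffLR (@nbhs_ballP _ _ u U) (open_nbhs_nbhs (conj oU Uu))).
have : (mu (ball u e) = 0)%E.
  case: fae0 => N [mN N0 sN]; apply: (subset_measure0 _ mN _ N0).
    by apply: open_measurable; exact: ball_open.
  move=> x /eU Ux; apply: sN => /= /(_ (UD _ Ux)) []; apply/eqP.
  by rewrite gt_eqF// fU.
by rewrite lebesgue_measure_ball ?ltW// => -[]; lra.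
Qed.

Lemma threshold_ruleE a eta d y :
  threshold_rule a eta d y = (eta < a * y ?<= if d).
Proof.
rewrite /threshold_rule; case: d => /=.
  by rewrite le_eqVlt eq_sym; case: eqP.
by case: eqP => [->|//]; rewrite ltxx.
Qed.

Lemma threshold_rule_gt a eta d y : eta < a * y -> threshold_rule a eta d y.
Proof. by rewrite threshold_ruleE; exact: lteifS. Qed.

Lemma threshold_rule_lt a eta d y :
  a * y < eta -> threshold_rule a eta d y = false.
Proof.
by move=> h; rewrite threshold_ruleE; apply/negbTE; rewrite -lteifNE lteifS.
Qed.

Lemma measurable_threshold_rule a eta d :
  measurable [set y | threshold_rule a eta d y].
Proof.
have ma : measurable_fun [set: R] ( *%R a) by exact: measurable_funM.
rewrite -[X in measurable X]setTI.
rewrite (_ : [set y | _] = *%R a @^-1` [set` Interval (BSide d eta) +oo%O]).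
  by apply: ma => //; exact: measurable_itv.
by apply/seteqP; split => y /=; rewrite threshold_ruleE in_itv/= andbT.
Qed.

End GaussianTests.

(** * The best response of the receiver *)

Section Receiver.
Variable R : realType.
Local Notation mu := (@lebesgue_measure R).
Implicit Types (a eta s m sigma : R) (d : bool) (g : R -> R) (A B : set R).
Implicit Types (p : params R) (S : R * R) (delta : R -> bool).

(** The excess of the integral of [g] over [A] above its minimum, which is
    attained on [B] because [B] separates the signs of [g]. *)
Lemma Rintegral_sign_diff A B g : measurable A -> measurable B ->
  mu.-integrable setT (EFin \o g) ->
  (forall y, B y -> g y <= 0) -> (forall y, ~ B y -> 0 <= g y) ->
  \int[mu]_(y in A) g y - \int[mu]_(y in B) g y =
  \int[mu]_(y in (A `\` B) `|` (B `\` A)) `|g y|.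
Proof.
move=> mA mB ig gB gNB.
have ires C : measurable C -> mu.-integrable setT (EFin \o (g \_ C)).
  move=> mC; rewrite -restrict_EFin -integrable_mkcond//; exact: integrableS ig.
rewrite (Rintegral_mkcond mu A) (Rintegral_mkcond mu B) (Rintegral_mkcond mu (_ `|` _)).
rewrite -RintegralB//; try exact: ires.
apply: eq_Rintegral => y _; rewrite /patch !in_setU !in_setD.
case: (asboolP (A y)) => [Ay|NAy]; case: (asboolP (B y)) => [By|NBy].
- by rewrite !mem_set//= subrr.
- by rewrite (mem_set Ay) (memNset NBy)/= subr0 ger0_norm ?gNB.
- by rewrite (memNset NAy) (mem_set By)/= sub0r ler0_norm ?gB.
- by rewrite !memNset//= subrr.
Qed.

(** Where [a y = eta], [g] vanishes, so the decision [d] is irrelevant. *)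
Lemma threshold_rule_sign a eta d g :
  (forall y, Num.sg (g y) = Num.sg (eta - a * y)) ->
  (forall y, [set y | threshold_rule a eta d y] y -> g y <= 0) /\
  (forall y, ~ [set y | threshold_rule a eta d y] y -> 0 <= g y).
Proof.
move=> sg; split=> y /=; rewrite threshold_ruleE.
  by move=> /lteifW h; rewrite -sgr_le0 sg sgr_le0 subr_le0.
by move=> /negP; rewrite -lteifNE => /lteifW h; rewrite -sgr_ge0 sg sgr_ge0 subr_ge0.
Qed.

(** If [g] has the sign of [eta - a y], then the rule [a y > eta] minimises the
    integral of [g] over the region of decision. *)
Lemma threshold_rule_opt a eta d g delta :
  mu.-integrable setT (EFin \o g) ->
  (forall y, Num.sg (g y) = Num.sg (eta - a * y)) ->
  measurable [set y | delta y] ->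
  \int[mu]_(y in [set y | threshold_rule a eta d y]) g y <=
  \int[mu]_(y in [set y | delta y]) g y.
Proof.
move=> ig /(threshold_rule_sign d)[gle0 gge0] mdelta.
rewrite -subr_ge0 Rintegral_sign_diff//; first exact: Rintegral_ge0.
exact: measurable_threshold_rule.
Qed.

(** That rule is the only non-constant minimiser among the threshold rules: two
    thresholds that disagree do so on an open set, where [g] does not vanish. *)
Lemma threshold_rule_unique a eta d a' eta' d' g :
  a != 0 -> a' != 0 ->
  mu.-integrable setT (EFin \o g) ->
  (forall y, Num.sg (g y) = Num.sg (eta - a * y)) ->
  \int[mu]_(y in [set y | threshold_rule a' eta' d' y]) g y <=
  \int[mu]_(y in [set y | threshold_rule a eta d y]) g y ->
  exists2 c, 0 < c & a' = c * a /\ eta' = c * eta.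
Proof.
move=> a0 a'0 ig sg le_int.
have [gle0 gge0] := threshold_rule_sign d sg.
have agree y : 0 <= (a' * y - eta') * (a * y - eta).
  rewrite leNgt; apply/negP => Uy; move: le_int; apply/negP; rewrite -ltNge.
  (* On [U], which contains [y], one rule decides [H_1] and the other [H_0]. *)
  pose U := [set y | (a' * y - eta') * (a * y - eta) < 0].
  rewrite -subr_gt0 Rintegral_sign_diff//; try exact: measurable_threshold_rule.
  apply: (@Rintegral_gt0 _ _ U).
  - by apply: measurableU; apply: measurableD; exact: measurable_threshold_rule.
  - have := integrable_norm ig; apply: integrableS => //.
    by apply: measurableU; apply: measurableD; exact: measurable_threshold_rule.
  - by [].
  - move=> z /=; rewrite /U/= => Uz; rewrite normr_gt0 -sgr_eq0 sg sgr_eq0.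
    by apply: contraTneq Uz => h; rewrite -(opprB eta) h oppr0 mulr0 ltxx.
  - rewrite /U; apply: (open_comp (f := fun y => (a' * y - eta') * (a * y - eta))
      (D := [set x | x < 0])); last exact: open_lt.
    move=> z _; apply: cvgM; apply: cvgB; try exact: cvg_cst;
      apply: cvgM; try exact: cvg_cst; exact: cvg_id.
  - by exists y.
  - move=> z; rewrite /U/= => Uz.
    have [h|h|h] := ltgtP (a * z) eta; last by nra.
    + have h' : eta' < a' * z by nra.
      left; split; first exact: threshold_rule_gt.
      by rewrite /= threshold_rule_lt.
    + have h' : a' * z < eta' by nra.
      right; split; first exact: threshold_rule_gt.
      by rewrite /= threshold_rule_lt.
have [th Eeta] : exists th, eta = a * th by exists (eta / a); field.
have [th' Eeta'] : exists th', eta' = a' * th' by exists (eta' / a'); field.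
have {}agree y : 0 <= a' * a * ((y - th') * (y - th)).
  by have := agree y; rewrite Eeta Eeta' -!mulrBr mulrACA.
(* To the right of both thresholds the product has the sign of [a' a]. *)
have aa'_gt0 : 0 < a' * a.
  rewrite lt_neqAle eq_sym mulf_neq0//=.
  have := agree (`|th| + `|th'| + 1); rewrite pmulr_lge0//.
  by apply: mulr_gt0; have := ler_norm th; have := ler_norm th';
    have := normr_ge0 th; have := normr_ge0 th'; lra.
(* At the midpoint of the two thresholds the product is a negative square. *)
have th_eq : th' = th.
  have := agree ((th + th') / 2); rewrite pmulr_rge0// => h.
  have : (th' - th) ^+ 2 <= 0 by rewrite expr2; lra.
  by rewrite real_exprn_even_le0 ?num_real//= subr_eq0 => /eqP.
exists (a' / a); last by split; rewrite ?divfK// Eeta' th_eq Eeta mulrA divfK.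
have -> : a' / a = a' * a / a ^+ 2 by field.
by rewrite divr_gt0// exprn_even_gt0.
Qed.

Lemma sgr_expRB x y : Num.sg (expR x - expR y) = Num.sg (x - y) :> R.
Proof.
have [xy|yx|->] := ltgtP x y; last by rewrite !subrr.
- by rewrite !ltr0_sg ?subr_lt0 ?ltr_expR.
- by rewrite !gtr0_sg ?subr_gt0 ?ltr_expR.
Qed.

(** The prior of [H_i] times the excess of the cost of an error under [H_i] over
    the cost of the right decision. *)
Definition weight p (i : bool) : R :=
  if i then prior p H1 * (cost p H0 H1 - cost p H1 H1)
  else prior p H0 * (cost p H1 H0 - cost p H0 H0).

Lemma tauE p : tau p = weight p H0 / weight p H1. Proof. by []. Qed.

(** The function whose integral over the region [delta = H1] is, up to a constant,
    the Bayes risk of [delta]. *)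
Definition risk_density sigma p S (y : R) : R :=
  weight p H0 * normal_pdf S.1 sigma y - weight p H1 * normal_pdf S.2 sigma y.

(** The value of [a y], for [a = zeta (S_1 - S_0)], at the observation [y] where
    the likelihood ratio [f_1 / f_0] equals [tau]. *)
Definition bayes_threshold sigma p S : R :=
  zeta p * (sigma ^+ 2 * ln (tau p) + (S.2 ^+ 2 - S.1 ^+ 2) / 2).

(** The comparison of the two weighted densities is affine in [y] after taking
    logarithms, because the quadratic terms in [y] cancel. *)
Lemma sgr_risk_density sigma p S y : 0 < sigma ->
  weight p H1 != 0 -> 0 < tau p -> Num.sg (weight p H1) = zeta p ->
  Num.sg (risk_density sigma p S y) =
  Num.sg (bayes_threshold sigma p S - zeta p * (S.2 - S.1) * y).
Proof.
move=> s0 w1 tau0 wz; have sn0 : sigma != 0 by rewrite gt_eqF.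
pose q s := - (y - s) ^+ 2 / (sigma ^+ 2 *+ 2).
have -> : risk_density sigma p S y =
    weight p H1 * normal_peak sigma * (expR (ln (tau p) + q S.1) - expR (q S.2)).
  rewrite expRD lnK ?posrE// {1}tauE /risk_density !normal_pdfE// /normal_fun.
  by rewrite -/(q S.1) -/(q S.2); field.
rewrite sgrM (sgrM (weight _ _)) sgr_expRB (gtr0_sg (normal_peak_gt0 sn0)) mulr1.
rewrite wz /bayes_threshold -mulrA -mulrBr.
have -> : sigma ^+ 2 * ln (tau p) + (S.2 ^+ 2 - S.1 ^+ 2) / 2 - (S.2 - S.1) * y =
    sigma ^+ 2 * (ln (tau p) + q S.1 - q S.2) by rewrite /q; field.
by rewrite [in RHS]sgrM sgr_id [in RHS]sgrM (gtr0_sg (exprn_gt0 2 s0)) mul1r.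
Qed.

Lemma integrable_scaled_normal_pdf m sigma c A : measurable A ->
  mu.-integrable A (EFin \o (fun y => c * normal_pdf m sigma y)).
Proof.
move=> mA; rewrite /comp; under eq_fun do rewrite EFinM.
apply: integrableZl => //.
exact: integrableS (integrable_normal_pdf m sigma).
Qed.

Lemma integrable_risk_density sigma p S :
  mu.-integrable setT (EFin \o risk_density sigma p S).
Proof.
exact: (integrableB measurableT
  (integrable_scaled_normal_pdf S.1 sigma (weight p H0) measurableT)
  (integrable_scaled_normal_pdf S.2 sigma (weight p H1) measurableT)).
Qed.

Lemma decision_probE sigma S delta i : sigma != 0 ->
  measurable [set y | delta y] ->
  decision_prob sigma S delta H1 i =
  \int[mu]_(y in [set y | delta y]) normal_pdf (signal S i) sigma y.
Proof.
move=> s0 md; rewrite /decision_prob.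
by rewrite (normal_prob_translation 0 (signal S i) s0 md) addr0.
Qed.

Lemma decision_prob_compl sigma S delta i : measurable [set y | delta y] ->
  decision_prob sigma S delta H0 i = 1 - decision_prob sigma S delta H1 i.
Proof.
move=> md; rewrite /decision_prob.
have -> : [set n | delta (signal S i + n) = H0] =
    ~` [set n | delta (signal S i + n) = H1].
  by apply/seteqP; split=> n /=; case: (delta _).
have mshift : measurable [set n | delta (signal S i + n) = H1].
  have := measurable_translation (signal S i) measurableT md.
  by rewrite setTI.
by rewrite probability_setC// fineB// fin_num_measure.
Qed.

Lemma bayes_riskE sigma p S delta : measurable [set y | delta y] ->
  bayes_risk sigma p S delta =
  prior p H0 * cost p H0 H0 + prior p H1 * cost p H0 H1 +
  (weight p H0 * decision_prob sigma S delta H1 H0 -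
   weight p H1 * decision_prob sigma S delta H1 H1).
Proof.
by move=> md; rewrite /bayes_risk !decision_prob_compl// /weight; ring.
Qed.

Lemma bayes_risk_density sigma p S delta : sigma != 0 ->
  measurable [set y | delta y] ->
  bayes_risk sigma p S delta =
  prior p H0 * cost p H0 H0 + prior p H1 * cost p H0 H1 +
  \int[mu]_(y in [set y | delta y]) risk_density sigma p S y.
Proof.
move=> s0 md; rewrite bayes_riskE// !decision_probE//; congr (_ + _).
have ipdf m : mu.-integrable [set y | delta y] (EFin \o normal_pdf m sigma).
  exact: integrableS (integrable_normal_pdf m sigma).
rewrite RintegralB//; try exact: integrable_scaled_normal_pdf.
by rewrite !RintegralZl//; exact: ipdf.
Qed.

End Receiver.

(** * The best response of the transmitter *)

Section Transmitter.
Variable R : realType.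
Local Notation mu := (@lebesgue_measure R).
Implicit Types (a b c eta s sigma w P : R) (d : bool) (f : R -> R).
Implicit Types (p t r : params R) (S : R * R) (delta : R -> bool).

Lemma open_affine_gt0 u v : open [set y : R | 0 < u * y + v].
Proof.
apply: (open_comp (f := fun y => u * y + v) (D := [set x | 0 < x])); last first.
  exact: open_gt.
move=> z _; apply: cvgD; last exact: cvg_cst.
by apply: cvgM; [exact: cvg_cst|exact: cvg_id].
Qed.

(** The probability of deciding [H_1] increases strictly with the signal, in the
    direction of [a]. *)
Lemma decision_prob_lt sigma a eta d S S' i : sigma != 0 -> a != 0 ->
  a * signal S i < a * signal S' i ->
  decision_prob sigma S (threshold_rule a eta d) H1 i <
  decision_prob sigma S' (threshold_rule a eta d) H1 i.
Proof.
move=> s0 a0; set s := signal S i; set s' := signal S' i => ss'.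
pose A x := [set n | threshold_rule a eta d (x + n)].
have mA x : measurable (A x).
  have := measurable_translation x measurableT (measurable_threshold_rule a eta d).
  by rewrite setTI.
have sAs' : A s `<=` A s'.
  move=> n /=; rewrite /A/= threshold_ruleE => /lteifW h; apply: threshold_rule_gt.
  by rewrite mulrDr in h *; lra.
have ipdf B : measurable B -> mu.-integrable B (EFin \o normal_pdf 0 sigma).
  by move=> mB; exact: integrableS (integrable_normal_pdf 0 sigma).
have -> : decision_prob sigma S (threshold_rule a eta d) H1 i =
  \int[mu]_(n in A s) normal_pdf 0 sigma n by [].
have -> : decision_prob sigma S' (threshold_rule a eta d) H1 i =
  \int[mu]_(n in A s') normal_pdf 0 sigma n by [].
have mD : measurable (A s' `\` A s) by exact: measurableD.
rewrite -(setDUK sAs') Rintegral_setU//; last 3 first.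
- exact: mA.
- by rewrite setDUK//; apply: ipdf; exact: mA.
- by rewrite disj_set2E; apply/eqP/seteqP; split=> // x [/= ? []].
(* On [U] the noise carries the observation across the threshold when the signal
   changes from [s] to [s']. *)
rewrite ltrDl; pose U := [set n | 0 < a * n + (a * s' - eta)] `&`
  [set n | 0 < (- a) * n + (eta - a * s)].
apply: (@Rintegral_gt0 _ _ U) => //.
- by apply: ipdf.
- by move=> x _; exact: normal_pdf_ge0.
- by move=> x _; exact: normal_pdf_gt0.
- by apply: openI; exact: open_affine_gt0.
- exists ((eta - a * (s + s') / 2) / a); rewrite /U/=.
  by rewrite mulNr mulrC divfK//; split; lra.
- move=> n [/= h' h]; split; first by apply: threshold_rule_gt; rewrite mulrDr; lra.
  by rewrite /A/= threshold_rule_lt// mulrDr; lra.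
Qed.

Lemma norm_le_sqrt s P : `|s| ^+ 2 <= P -> `|s| <= Num.sqrt P.
Proof. by move=> /ler_wsqrtr; rewrite sqrtr_sqr normr_id. Qed.

(** If [f s] increases strictly with [a s], then [w f] has a unique minimiser
    between [- sqrt P] and [sqrt P], which is an end point. *)
Lemma monotone_minimiser a w f s P : a != 0 -> w != 0 ->
  (forall x x', a * x < a * x' -> f x < f x') -> `|s| ^+ 2 <= P ->
  s = - Num.sg (w * a) * Num.sqrt P \/
  w * f (- Num.sg (w * a) * Num.sqrt P) < w * f s.
Proof.
move=> a0 w0 f_lt /norm_le_sqrt; set m := _ * Num.sqrt P; rewrite ler_norml => sP.
have [->|sm] := eqVneq s m; [by left|right].
have wam : w * a * m < w * a * s.
  move: sm; rewrite /m; have wa0 : w * a != 0 by rewrite mulf_neq0.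
  have [wa|wa|wa] := ltgtP (w * a) 0; last by rewrite wa eqxx in wa0.
  - by rewrite ltr0_sg// opprK mul1r ltr_nM2l// lt_neqAle => ->; lra.
  - by rewrite gtr0_sg// mulN1r ltr_pM2l// lt_neqAle eq_sym => ->; lra.
rewrite -!mulrA in wam.
have [w_lt0|w_gt0|w_eq0] := ltgtP w 0; last by rewrite w_eq0 eqxx in w0.
- by rewrite ltr_nM2l//; apply: f_lt; rewrite -(ltr_nM2l w_lt0).
- by rewrite ltr_pM2l//; apply: f_lt; rewrite -(ltr_pM2l w_gt0).
Qed.

(** The signals that a transmitter whose weights have the sign [z] sends against a
    rule whose coefficient [a] has the sign [b]. *)
Definition extreme_signals P0 P1 (z b : R) : R * R :=
  (- (b * z) * Num.sqrt P0, b * z * Num.sqrt P1).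

(** Any other feasible pair of signals is strictly worse than the extreme one. *)
Lemma transmitter_best_response sigma P0 P1 p a eta d z S :
  sigma != 0 -> a != 0 -> z != 0 ->
  (forall i, Num.sg (weight p i) = z) -> signal_set P0 P1 S ->
  let S' := extreme_signals P0 P1 z (Num.sg a) in
  S = S' \/ bayes_risk sigma p S' (threshold_rule a eta d) <
            bayes_risk sigma p S (threshold_rule a eta d).
Proof.
move=> s0 a0 z0 wz [/= S0 S1]; cbv zeta.
have w0 i : weight p i != 0 by rewrite -sgr_eq0 wz.
have md := measurable_threshold_rule a eta d.
rewrite !bayes_riskE// ltrD2l.
pose f s := decision_prob sigma (s, s) (threshold_rule a eta d) H1 H0.
have f_lt x x' : a * x < a * x' -> f x < f x' by move=> h; exact: decision_prob_lt.
have fE0 s s' : decision_prob sigma (s, s') (threshold_rule a eta d) H1 H0 = f s by [].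
have fE1 s s' : decision_prob sigma (s', s) (threshold_rule a eta d) H1 H1 = f s by [].
(* The risk increases with [P_10] but decreases with [P_11] when [z = 1], whence
   the opposite signs of the two signals. *)
have wN0 : - weight p H1 != 0 by rewrite oppr_eq0.
have e0 : - Num.sg (weight p H0 * a) = - (Num.sg a * z).
  by rewrite (sgrM (weight p H0)) wz mulrC.
have e1 : - Num.sg (- weight p H1 * a) = Num.sg a * z.
  by rewrite mulNr sgrN opprK (sgrM (weight p H1)) wz mulrC.
have := monotone_minimiser a0 (w0 H0) f_lt S0.
have := monotone_minimiser a0 wN0 f_lt S1.
rewrite e0 e1; case: S S0 S1 => [s s'] /= _ _; rewrite /extreme_signals !fE0 !fE1.
rewrite -!(mulNr (weight p H1)).
move=> [->|h1] [->|h0]; [by left|right|right|right].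
- by rewrite ltrD2r.
- by rewrite ltrD2l.
- exact: ltrD.
Qed.

Lemma threshold_ruleZ c a eta d : 0 < c ->
  threshold_rule (c * a) (c * eta) d = threshold_rule a eta d.
Proof.
move=> c0; apply/funext => y; rewrite !threshold_ruleE -mulrA.
by case: d => /=; rewrite ?ler_pM2l ?ltr_pM2l.
Qed.

Lemma threshold_rule_inj a eta eta' d d' : a != 0 ->
  threshold_rule a eta d = threshold_rule a eta' d' -> eta = eta'.
Proof.
move=> a0; have le_eta x x' e e' :
    threshold_rule a x e = threshold_rule a x' e' -> x <= x'.
  move=> /(congr1 (fun delta => delta ((x + x') / 2 / a))).
  rewrite leNgt => E; apply/negP => x'x; move: E.
  by rewrite threshold_rule_lt ?threshold_rule_gt//;
    rewrite [a * _]mulrC divfK//; lra.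
by move=> E; apply/eqP; rewrite eq_le (le_eta _ _ _ _ E) (le_eta _ _ _ _ (esym E)).
Qed.

Lemma threshold_rule_ignores a eta d :
  ignores_observation (threshold_rule a eta d) <-> a = 0.
Proof.
split=> [ign|-> y y']; last by rewrite /threshold_rule !mul0r.
apply/eqP/negP => /negP a0; have := ign ((eta + 1) / a) ((eta - 1) / a).
rewrite threshold_rule_gt; last by rewrite mulrC divfK//; lra.
by rewrite threshold_rule_lt//; rewrite mulrC divfK//; lra.
Qed.

End Transmitter.

(** * Informative equilibria *)

Section Equilibria.
Variable R : realType.
Implicit Types (a b eta sigma P : R) (d : bool).
Implicit Types (p t r : params R) (S : R * R) (delta : R -> bool).

(** The two candidate equilibria [(S_0, S_1, a, eta)]; [b = 1] or [b = -1] is the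
    sign of [a]. *)
Definition equilibrium_policy sigma P0 P1 r b : R * R * R * R :=
  let S := extreme_signals P0 P1 (zeta r) b in
  (S.1, S.2, b * (Num.sqrt P0 + Num.sqrt P1), bayes_threshold sigma r S).

Lemma bayes_risk_ignores sigma p S S' delta : ignores_observation delta ->
  bayes_risk sigma p S delta = bayes_risk sigma p S' delta.
Proof.
move=> ign; rewrite /bayes_risk.
have E j i : decision_prob sigma S delta j i = decision_prob sigma S' delta j i.
  rewrite /decision_prob; congr (fine (normal_prob _ _ _)); apply/seteqP.
  by split=> n /=; rewrite (ign (signal S i + n) (signal S' i + n)).
by rewrite !E.
Qed.

(** Against a constant rule every signal is a best response of any transmitter. *)
Lemma nash_ignores sigma P0 P1 t t' r S delta : ignores_observation delta ->
  nash sigma P0 P1 t r S delta -> nash sigma P0 P1 t' r S delta.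
Proof.
move=> ign [hS hd _ hr]; split=> // S' _.
by rewrite (bayes_risk_ignores _ _ S S').
Qed.

Section SignedWeights.
Variables (sigma P0 P1 : R) (t r : params R).
Hypotheses (sigma_gt0 : 0 < sigma) (P0_gt0 : 0 < P0) (P1_gt0 : 0 < P1).
Hypotheses (z_neq0 : zeta r != 0) (tau_gt0 : 0 < tau r).
Hypothesis weight_r : forall i, Num.sg (weight r i) = zeta r.
Hypothesis weight_t : forall i, Num.sg (weight t i) = zeta r.

Let zz : zeta r * zeta r = 1.
Proof. by rewrite -expr2 /zeta sqr_sg -sgr_eq0 -/(zeta r) z_neq0. Qed.

Let sqrt_gt0 : 0 < Num.sqrt P0 + Num.sqrt P1.
Proof. by rewrite addr_gt0// sqrtr_gt0. Qed.

Lemma policy_coefficient b :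
  zeta r * ((extreme_signals P0 P1 (zeta r) b).2 -
            (extreme_signals P0 P1 (zeta r) b).1) =
  b * (Num.sqrt P0 + Num.sqrt P1).
Proof.
rewrite /extreme_signals/=.
transitivity (zeta r * zeta r * (b * (Num.sqrt P0 + Num.sqrt P1))); first by ring.
by rewrite zz mul1r.
Qed.

Lemma sgr_risk_density_policy b y :
  let S := extreme_signals P0 P1 (zeta r) b in
  Num.sg (risk_density sigma r S y) =
  Num.sg (bayes_threshold sigma r S - b * (Num.sqrt P0 + Num.sqrt P1) * y).
Proof.
cbv zeta; rewrite sgr_risk_density//; first by rewrite policy_coefficient.
by rewrite -sgr_eq0 weight_r.
Qed.

Lemma extreme_signals_feasible b : b = 1 \/ b = -1 ->
  signal_set P0 P1 (extreme_signals P0 P1 (zeta r) b).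
Proof.
have z1 : `|zeta r| = 1 by rewrite /zeta normr_sg -sgr_eq0 -/(zeta r) z_neq0.
move=> b1; have {}b1 : `|b| = 1 by case: b1 => ->; rewrite ?normrN normr1.
rewrite /signal_set/= !normrM normrN !normrM b1 z1 !mul1r.
by split; rewrite ger0_norm ?sqrtr_ge0// sqr_sqrtr//; exact: ltW.
Qed.

(** The right-hand side does not mention [t]: only the sign of its weights
    matters. *)
Lemma informative_nashP S delta :
  informative_nash sigma P0 P1 t r S delta <->
  exists2 b, b = 1 \/ b = -1 &
    plays (equilibrium_policy sigma P0 P1 r b) S delta.
Proof.
have s0 : sigma != 0 by rewrite gt_eqF.
split=> [[[hS [a [eta [d ->]]] ht hr] inf]|[b b1 [-> [d ->]]]].
- have a0 : a != 0 by apply/eqP => a0; apply: inf; apply/threshold_rule_ignores.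
  have b1 : Num.sg a = 1 \/ Num.sg a = -1.
    by case: sgrP a0 => //; [left|right].
  have SE : S = extreme_signals P0 P1 (zeta r) (Num.sg a).
    have [//|] := transmitter_best_response eta d s0 a0 z_neq0 weight_t hS.
    by rewrite ltNge ht//; exact: extreme_signals_feasible.
  exists (Num.sg a) => //; split; first by rewrite SE.
  pose astar := Num.sg a * (Num.sqrt P0 + Num.sqrt P1).
  pose etastar :=
    bayes_threshold sigma r (extreme_signals P0 P1 (zeta r) (Num.sg a)).
  exists d; rewrite -/astar -/etastar.
  have astar0 : astar != 0.
    by rewrite /astar mulf_neq0 ?sgr_eq0// gt_eqF.
  have := hr _ (ex_intro _ astar (ex_intro _ etastar (ex_intro _ d erefl))).
  rewrite !bayes_risk_density//; try exact: measurable_threshold_rule.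
  rewrite lerD2l SE => /(threshold_rule_unique astar0 a0
    (integrable_risk_density _ _ _) (sgr_risk_density_policy _)).
  by move=> [c c0 [aE etaE]]; rewrite [in LHS]aE [in LHS]etaE threshold_ruleZ.
- set a := b * _; set eta := bayes_threshold _ _ _.
  have b0 : b != 0 by case: b1 => ->; rewrite ?oppr_eq0 oner_eq0.
  have a0 : a != 0 by rewrite mulf_neq0 // gt_eqF.
  have sga : Num.sg a = b.
    by rewrite /a sgrM (gtr0_sg sqrt_gt0) mulr1; case: b1 => ->; rewrite ?sgrN sgr1.
  rewrite -surjective_pairing; split; last first.
    by move=> /threshold_rule_ignores/eqP; apply/negP.
  split; [exact: extreme_signals_feasible| by exists a, eta, d| |].
  + move=> S' hS'.
    have := transmitter_best_response eta d s0 a0 z_neq0 weight_t hS'.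
    by rewrite sga => -[->//|/ltW].
  + move=> _ [a' [eta' [d' ->]]].
    rewrite !bayes_risk_density//; try exact: measurable_threshold_rule.
    rewrite lerD2l; apply: threshold_rule_opt.
    * exact: integrable_risk_density.
    * by move=> y; exact: sgr_risk_density_policy.
    * exact: measurable_threshold_rule.
Qed.

Lemma informative_policiesE :
  informative_policies sigma P0 P1 t r =
  [set equilibrium_policy sigma P0 P1 r 1; equilibrium_policy sigma P0 P1 r (-1)].
Proof.
apply/seteqP; split=> [[[[S0 S1] a] eta]|q].
- move=> [aE [d /informative_nashP [b b1 [[E0 E1] [d' dE]]]]].
  have astar : a = b * (Num.sqrt P0 + Num.sqrt P1) by rewrite aE E0 E1 policy_coefficient.
  have b0 : b != 0 by case: b1 => ->; rewrite ?oppr_eq0 oner_eq0.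
  have a0 : a != 0 by rewrite astar mulf_neq0 // gt_eqF.
  have etaE : eta = bayes_threshold sigma r (extreme_signals P0 P1 (zeta r) b).
    by move: dE; rewrite -astar; exact: threshold_rule_inj.
  by case: b1 => b1; [left|right]; rewrite E0 E1 etaE astar b1.
- move=> bq; have [b b1 ->] : exists2 b, b = 1 \/ b = -1 &
      q = equilibrium_policy sigma P0 P1 r b.
    by case: bq => ->; [exists 1; [left|]|exists (-1); [right|]].
  split; first by rewrite policy_coefficient.
  by exists true; apply/informative_nashP; exists b => //; split=> //; exists true.
Qed.

End SignedWeights.
End Equilibria.

(** * Perturbations *)

Lemma continuous_snd (X Y : topologicalType) :
  continuous (fun p : X * Y => p.2).
Proof. by move=> p; exact: cvg_snd. Qed.

Lemma continuous_comp_fst (X Y Z : topologicalType) (f : X -> Z) :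
  continuous f -> continuous (fun p : X * Y => f p.1).
Proof. by move=> cf p; apply: cvg_comp; [exact: cvg_fst|exact: cf]. Qed.

Section Perturbation.
Variables (R : realType) (sigma P0 P1 : R) (r : params R).
Hypotheses (sigma_gt0 : 0 < sigma) (P0_gt0 : 0 < P0) (P1_gt0 : 0 < P1).
Hypotheses (r_valid : valid_params r) (tau_gt0 : 0 < tau r).
Hypothesis tau_finite : prior r H1 * (cost r H0 H1 - cost r H1 H1) != 0.
Local Notation perturbation := (R * R * R * R * R * R)%type.
Implicit Types (e : perturbation) (S : R * R) (delta : R -> bool).

(** Each cost difference varies by less than its absolute value at the receiver. *)
Definition small_perturbation e : Prop :=
  `|(eps_cost e H1 H0 - eps_cost e H0 H0) / (cost r H1 H0 - cost r H0 H0)| < 1 /\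
  `|(eps_cost e H0 H1 - eps_cost e H1 H1) / (cost r H0 H1 - cost r H1 H1)| < 1.

Lemma prior_r_gt0 i : 0 < prior r i.
Proof.
have [prior_ge0 _ _] := r_valid; rewrite lt_neqAle prior_ge0 andbT eq_sym.
move: tau_finite tau_gt0; rewrite /tau mulf_eq0 negb_or.
case: i => [/andP[]//|_]; apply: contraTneq => ->.
by rewrite mul0r mul0r ltxx.
Qed.

Lemma sgr_weight_receiver i : Num.sg (weight r i) = zeta r.
Proof.
have w1 : Num.sg (weight r H1) = zeta r.
  by rewrite /weight sgrM (gtr0_sg (prior_r_gt0 _)) mul1r.
case: i => //; rewrite -w1 -(divfK tau_finite (weight r H0)).
by rewrite sgrM -[_ / _]/(tau r) gtr0_sg// mul1r.
Qed.

Lemma zeta_neq0 : zeta r != 0.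
Proof. by rewrite -(sgr_weight_receiver H1) sgr_eq0. Qed.

Lemma cost_diff_neq0 :
  cost r H1 H0 - cost r H0 H0 != 0 /\ cost r H0 H1 - cost r H1 H1 != 0.
Proof.
split; last by move: tau_finite; rewrite mulf_eq0 negb_or => /andP[].
have : weight r H0 != 0 by rewrite -sgr_eq0 sgr_weight_receiver zeta_neq0.
by rewrite /weight mulf_eq0 negb_or => /andP[].
Qed.

Lemma ratio_perturbed_gt0 (x u v a b : R) : x != 0 -> u - v = x ->
  `|(a - b) / x| < 1 -> 0 < (u + a - (v + b)) / x.
Proof.
move=> x0 uv; rewrite ltr_norml => /andP[h _].
have -> : (u + a - (v + b)) / x = 1 + (a - b) / x by rewrite -uv in x0 *; field.
lra.
Qed.

Lemma xi_gt0 e : small_perturbation e ->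
  let t := perturb r e in
  0 < (cost t H1 H0 - cost t H0 H0) / (cost r H1 H0 - cost r H0 H0) /\
  0 < (cost t H0 H1 - cost t H1 H1) / (cost r H0 H1 - cost r H1 H1).
Proof.
by move=> [h0 h1]; have [x0 x1] := cost_diff_neq0; split; exact: ratio_perturbed_gt0.
Qed.

Lemma sgr_weight_transmitter e i : admissible r e -> small_perturbation e ->
  Num.sg (weight (perturb r e) i) = zeta r.
Proof.
move=> [[prior_ge0 _ _] ac] /xi_gt0[xi0 xi1]; have [x0 x1] := cost_diff_neq0.
rewrite -(sgr_weight_receiver i).
have prior_gt0 j : 0 < prior (perturb r e) j.
  rewrite lt_neqAle prior_ge0 andbT eq_sym; apply/eqP => /ac/eqP.
  by rewrite gt_eqF// prior_r_gt0.
case: i; rewrite /weight !sgrM !(gtr0_sg (prior_gt0 _)) !(gtr0_sg (prior_r_gt0 _)).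
  by rewrite -[in LHS](divfK x1 (_ - _)) sgrM (gtr0_sg xi1) !mul1r.
by rewrite -[in LHS](divfK x0 (_ - _)) sgrM (gtr0_sg xi0) !mul1r.
Qed.

Lemma informative_nash_perturb e S delta :
  admissible r e -> small_perturbation e ->
  informative_nash sigma P0 P1 (perturb r e) r S delta <->
  exists2 b, b = 1 \/ b = -1 & plays (equilibrium_policy sigma P0 P1 r b) S delta.
Proof.
move=> adm small; apply: informative_nashP => //; first exact: zeta_neq0.
- exact: sgr_weight_receiver.
- by move=> i; exact: sgr_weight_transmitter.
Qed.

Lemma informative_policies_perturb e :
  admissible r e -> small_perturbation e ->
  informative_policies sigma P0 P1 (perturb r e) r =
  [set equilibrium_policy sigma P0 P1 r 1; equilibrium_policy sigma P0 P1 r (-1)].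
Proof.
move=> adm small; apply: informative_policiesE => //; first exact: zeta_neq0.
- exact: sgr_weight_receiver.
- by move=> i; exact: sgr_weight_transmitter.
Qed.

Lemma nash_perturb e S delta : admissible r e -> small_perturbation e ->
  nash sigma P0 P1 (perturb r e) r S delta <-> nash sigma P0 P1 r r S delta.
Proof.
move=> adm small; have [ign|inf] := pselect (ignores_observation delta).
  by split; exact: nash_ignores.
have rP := informative_nashP sigma_gt0 P0_gt0 P1_gt0 zeta_neq0 tau_gt0
  sgr_weight_receiver sgr_weight_receiver S delta.
have tP := informative_nash_perturb S delta adm small.
by split=> ne; [case: (iffRL rP)|case: (iffRL tP)] => //; [apply/tP|apply/rP].
Qed.

Lemma continuous_eps_cost k l : continuous (fun e => eps_cost e k l).
Proof.
have -> : (fun e => eps_cost e k l) =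
   (fun e => if k then (if l then e.2 else e.1.2)
             else (if l then e.1.1.2 else e.1.1.1.2)).
  by apply/funext => -[[[[[? ?] ?] ?] ?] ?].
pose R2 := (R * R)%type; pose R3 := (R2 * R)%type.
pose R4 := (R3 * R)%type; pose R5 := (R4 * R)%type.
case: k; case: l.
- exact: (@continuous_snd R5 R).
- exact: (@continuous_comp_fst R5 R R (fun p => p.2) (@continuous_snd R4 R)).
- exact: (@continuous_comp_fst R5 R R (fun p => p.1.2)
    (@continuous_comp_fst R4 R R _ (@continuous_snd R3 R))).
- exact: (@continuous_comp_fst R5 R R (fun p => p.1.1.2)
    (@continuous_comp_fst R4 R R (fun p => p.1.2)
      (@continuous_comp_fst R3 R R _ (@continuous_snd R2 R)))).
Qed.

Lemma near_small_perturbation :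
  \forall e \near (0 : perturbation), small_perturbation e.
Proof.
have near_lt1 k l k' l' x :
    \forall e \near (0 : perturbation), `|(eps_cost e k l - eps_cost e k' l') / x| < 1.
  pose f e := `|(eps_cost e k l - eps_cost e k' l') / x|.
  have f_cvg : f e @[e --> (0 : perturbation)] --> f 0.
    apply: cvg_norm; apply: cvgM; last exact: cvg_cst.
    by apply: cvgB; exact: continuous_eps_cost.
  have f0 : f 0 < 1.
    have eps0 i j : eps_cost (0 : perturbation) i j = 0 by case: i; case: j.
    by rewrite /f !eps0 subrr mul0r normr0.
  exact: (cvgr_lt _ f_cvg _ f0).
exact: filterI (near_lt1 H1 H0 H0 H0 _) (near_lt1 H0 H1 H1 H1 _).
Qed.

Lemma continuous_informative_policies e :
  admissible r e -> (\forall z \near e, small_perturbation z) ->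
  continuous_set_valued (admissible r)
    (fun e' => informative_policies sigma P0 P1 (perturb r e') r) e.
Proof.
move=> adm near_e; have small := nbhs_singleton near_e.
pose F e' := informative_policies sigma P0 P1 (perturb r e') r.
have F_const : \forall z \near within (admissible r) (nbhs e), F z = F e.
  rewrite near_withinE; apply: filterS near_e => z small_z adm_z.
  by rewrite /F !informative_policies_perturb.
by move=> U _; split=> FU; apply: filterS F_const => z; rewrite /F => ->.
Qed.

End Perturbation.

Unset Implicit Arguments.
Set Strict Implicit.

(** * The theorem *)

Theorem mainTheorem4 (R : realType) (sigma P0 P1 : R) (r : params R)
  (sigma_gt0 : 0 < sigma) (P0_gt0 : 0 < P0) (P1_gt0 : 0 < P1)
  (r_valid : valid_params r)
  (tau_finite : prior r H1 * (cost r H0 H1 - cost r H1 H1) != 0)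
  (tau_gt0 : 0 < tau r) :
  (forall e : R * R * R * R * R * R,
    let t := perturb r e in
    let xi0 := (cost t H1 H0 - cost t H0 H0) / (cost r H1 H0 - cost r H0 H0) in
    let xi1 := (cost t H0 H1 - cost t H1 H1) / (cost r H0 H1 - cost r H1 H1) in
    let eta (S0 S1 : R) :=
      zeta r * (sigma ^+ 2 * ln (tau r) + (S1 ^+ 2 - S0 ^+ 2) / 2) in
    let q1 : R * R * R * R :=
      (- zeta r * Num.sqrt P0, zeta r * Num.sqrt P1,
       Num.sqrt P0 + Num.sqrt P1,
       eta (- zeta r * Num.sqrt P0) (zeta r * Num.sqrt P1)) in
    let q2 : R * R * R * R :=
      (zeta r * Num.sqrt P0, - zeta r * Num.sqrt P1,
       - (Num.sqrt P0 + Num.sqrt P1),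
       eta (zeta r * Num.sqrt P0) (- zeta r * Num.sqrt P1)) in
    admissible r e ->
    `|(eps_cost e H1 H0 - eps_cost e H0 H0) /
        (cost r H1 H0 - cost r H0 H0)| < 1 ->
    `|(eps_cost e H0 H1 - eps_cost e H1 H1) /
        (cost r H0 H1 - cost r H1 H1)| < 1 ->
    [/\ 0 < xi0, 0 < xi1,
        informative_policies sigma P0 P1 t r = [set q1; q2] &
        forall (S : R * R) (delta : R -> bool),
          informative_nash sigma P0 P1 t r S delta <->
          plays q1 S delta \/ plays q2 S delta])
  /\
  (\forall e \near (0 : R * R * R * R * R * R), admissible r e ->
    (forall (S : R * R) (delta : R -> bool),
       nash sigma P0 P1 (perturb r e) r S delta <->
       nash sigma P0 P1 r r S delta) /\
    continuous_set_valued (admissible r)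
      (fun e' => informative_policies sigma P0 P1 (perturb r e') r) e).
Proof.
have policyE b S0 S1 : S0 = - (b * zeta r) * Num.sqrt P0 ->
    S1 = b * zeta r * Num.sqrt P1 ->
    (S0, S1, b * (Num.sqrt P0 + Num.sqrt P1),
     zeta r * (sigma ^+ 2 * ln (tau r) + (S1 ^+ 2 - S0 ^+ 2) / 2)) =
    equilibrium_policy sigma P0 P1 r b by move=> -> ->.
split.
- move=> e t xi0 xi1 eta q1 q2 adm h0 h1.
  have small : small_perturbation r e by [].
  have q1E : q1 = equilibrium_policy sigma P0 P1 r 1.
    by rewrite /q1 -(mul1r (Num.sqrt P0 + _)); apply: policyE; rewrite mul1r.
  have q2E : q2 = equilibrium_policy sigma P0 P1 r (-1).
    by rewrite /q2 -(mulN1r (Num.sqrt P0 + _)); apply: policyE;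
      rewrite mulN1r ?opprK.
  have [xi0_gt0 xi1_gt0] := xi_gt0 r_valid tau_gt0 tau_finite small.
  rewrite q1E q2E; split=> //; first exact: informative_policies_perturb.
  move=> S delta; split.
  + move/(informative_nash_perturb sigma_gt0 P0_gt0 P1_gt0 r_valid tau_gt0 tau_finite
      S delta adm small).
    by move=> [b [->|->] pl]; [left|right].
  + move=> pl; apply/informative_nash_perturb => //.
    by case: pl => pl; [exists 1; first left|exists (-1); first right].
- have := near_join (near_small_perturbation r).
  apply: filterS => e near_e adm; have small := nbhs_singleton near_e.
  split; last exact: continuous_informative_policies.
  by move=> S delta; exact: nash_perturb.
Qed.
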